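(* Let $G\ne\mathcal{K}_n$ be a simple graph on $[n]$, let $K$ be a field, and let $J_G\subseteq S=K[x_1,\dots,x_n,y_1,\dots,y_n]$ be its binomial edge ideal. Then $$(J_G:J_{\mathcal{K}_n})=\bigcap_{e\notin E(G)}(J_G:f_e)=J_G+\bigl(g_{C,D}\mid C\cup D\in\mathcal{D}_c(G),\ C\cap D=\emptyset\bigr),$$ where $g_{C,D}:=\prod_{k\in C}x_k\prod_{k\in D}y_k$ for $C,D\subseteq[n]$.
   Context: $[n]=\{1,\dots,n\}$, and $\mathcal{K}_n$ is the complete graph on $[n]$. Graphs are finite and simple (no loops, no multiple edges). For distinct $i,j\in[n]$ with $i<j$ and $e=\{i,j\}$, $f_e=f_{ij}:=x_iy_j-x_jy_i$. The binomial edge ideal of $G$ is $J_G=(f_e\mid e\in E(G))\subseteq S$; thus $J_{\mathcal{K}_n}$ is generated by all $f_{ij}$ with $1\le i<j\le n$. In the intersection, $e$ runs over all two-element subsets of $[n]$ that are not edges of $G$. $\mathcal{D}_c(G)$ is the family of all $B\subseteq[n]$ such that for every pair of distinct vertices $i,j$ with $\{i,j\}\notin E(G)$ there exists a path $i,i_1,\dots,i_s,j$ in $G$ with $\{i_1,\dots,i_s\}\subseteq B$. *)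

(* Defs.v *)
From mathcomp Require Import all_boot all_order all_algebra.
From mathcomp Require Import mpoly.
From mathcomp Require Import classical_sets.

Set Implicit Arguments.
Unset Strict Implicit.
Unset Printing Implicit Defensive.

Import GRing.Theory.

Local Open Scope classical_set_scope.
Local Open Scope ring_scope.

Section Ideals.
Variable R : comNzRingType.

(* The library's [idealr] requires boolean membership and excludes the unit
   ideal; here ideals are arbitrary subsets of R and may be improper. *)
Definition is_ideal (I : set R) : Prop :=
  [/\ I 0, forall p q, I p -> I q -> I (p + q) & forall a p, I p -> I (a * p)].

Definition ideal_gen (A : set R) : set R := smallest is_ideal A.

Definition ideal_add (I J : set R) : set R := [set p + q | p in I & q in J].

(* [A] may be any subset: (I : f) is [colon I [set f]]. *)
Definition colon (I A : set R) : set R :=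
  [set p | forall q, A q -> I (p * q)].

End Ideals.

(* The vertex set [n] is 'I_n (0-based, same order); a graph is its adjacency
   relation, with the edge {i, j} encoded by [G i j]. *)
Definition complete_graph (n : nat) : rel 'I_n := fun i j => i != j.
Arguments complete_graph n : clear implicits.

(* Two-element subsets {i, j} are represented by the pairs with i < j. *)
Definition nonedges (n : nat) (G : rel 'I_n) : set ('I_n * 'I_n) :=
  [set e : 'I_n * 'I_n | (e.1 < e.2)%N /\ ~~ G e.1 e.2].

(* The path i, i_1, ..., i_s, j is [i :: rcons s j]; its vertices are distinct. *)
Definition Dc (n : nat) (G : rel 'I_n) (B : {set 'I_n}) : Prop :=
  forall i j : 'I_n, i != j -> ~~ G i j ->
    exists s : seq 'I_n,
      [/\ path G i (rcons s j), uniq (i :: rcons s j) & {subset s <= B}].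

Section BinomialEdgeIdeal.
Variables (K : fieldType) (n : nat).

(* K[x_1, ..., x_n, y_1, ..., y_n]: the x's come first, then the y's. *)
Definition xvar (i : 'I_n) : {mpoly K[n + n]} := 'X_(lshift n i).
Definition yvar (i : 'I_n) : {mpoly K[n + n]} := 'X_(rshift n i).

Definition edge_binom (i j : 'I_n) : {mpoly K[n + n]} :=
  xvar i * yvar j - xvar j * yvar i.

Definition binom_edge_ideal (G : rel 'I_n) : set {mpoly K[n + n]} :=
  ideal_gen [set p | exists i j : 'I_n, [/\ (i < j)%N, G i j & p = edge_binom i j]].

Definition gmon (C D : {set 'I_n}) : {mpoly K[n + n]} :=
  (\prod_(k in C) xvar k) * (\prod_(k in D) yvar k).

Definition gmon_ideal (G : rel 'I_n) : set {mpoly K[n + n]} :=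
  ideal_gen [set p | exists C D : {set 'I_n},
    [/\ Dc G (C :|: D)%SET, (C :&: D)%SET = finset.set0 & p = gmon C D]].

End BinomialEdgeIdeal.

Arguments binom_edge_ideal K [n] G.
Arguments gmon_ideal K [n] G.

(* Main.v *)
Require Import Defs.
From mathcomp Require Import all_boot all_order all_algebra.
From mathcomp Require Import mpoly.
From mathcomp Require Import classical_sets.
From mathcomp Require Import zify ring.

(** S is Z^n-graded with x_k and y_k in degree e_k, and J_G, hence each colon
    ideal (J_G : f_e), is homogeneous; so it suffices to treat p homogeneous of
    degree a with p f_e in J_G for every non-edge e. Let B be the support of a.
    If B is in D_c(G), every monomial of p is divisible by some g_{C,D} with
    C :|: D = B. Otherwise there are A containing B and a non-edge {i,j} of A,
    disconnected in G[A], such that vertices of B connected in G[A] are already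
    connected in G[B]: take A = B if G[B] is disconnected, and A = B with i, j
    added for a pair violating D_c(G) if not. Let c choose a representative in
    each component of G[A]. The map x_k |-> x_{c(k)}, y_k |-> y_{c(k)}, killing
    the variables outside A, kills J_G but not f_ij, so it kills p. In degree a
    its kernel is spanned by differences of monomials related by swaps
    x_l y_k -> x_k y_l with k, l connected in G[B]; each swap changes the
    monomial by an element of J_G, because all variables indexed by the interior
    vertices of a path from k to l in G[B] are available in degree a. *)

Set Implicit Arguments.
Unset Strict Implicit.
Unset Printing Implicit Defensive.

Import GRing.Theory.

Local Open Scope classical_set_scope.
Local Open Scope ring_scope.

(** * Ideals of a commutative ring, their colons and sums *)

Section IdealTheory.
Variable R : comNzRingType.

Lemma ideal_gen_ideal (A : set R) : is_ideal (ideal_gen A).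
Proof.
split.
- by move=> I [[I0 _ _] _].
- by move=> p q Ip Iq I hI; case: (hI) => -[_ ID _] _; apply: ID; [apply: Ip|apply: Iq].
- by move=> a p Ip I hI; case: (hI) => -[_ _ IM] _; apply: IM; apply: Ip.
Qed.

Lemma mem_ideal_gen (A : set R) p : A p -> ideal_gen A p.
Proof. exact: (@sub_gen_smallest _ (@is_ideal R) A p). Qed.

Lemma ideal_gen_sub (A I : set R) : is_ideal I -> A `<=` I -> ideal_gen A `<=` I.
Proof. exact: smallest_sub. Qed.

Variable I : set R.
Hypothesis hI : is_ideal I.

Lemma ideal0 : I 0. Proof. by case: hI. Qed.

Lemma idealD p q : I p -> I q -> I (p + q).
Proof. by case: hI => _ h _; apply: h. Qed.

Lemma idealMl a p : I p -> I (a * p).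
Proof. by case: hI => _ _; apply. Qed.

Lemma idealMr a p : I p -> I (p * a).
Proof. by rewrite mulrC; apply: idealMl. Qed.

Lemma idealN p : I p -> I (- p).
Proof. by rewrite -mulN1r; apply: idealMl. Qed.

Lemma ideal_sum (T : eqType) (r : seq T) (P : pred T) (F : T -> R) :
  (forall t, t \in r -> P t -> I (F t)) -> I (\sum_(t <- r | P t) F t).
Proof.
move=> h; rewrite big_seq_cond.
by apply: big_ind => [|p q|t /andP[]]; [exact: ideal0 | exact: idealD | exact: h].
Qed.

Lemma colon_ideal (A : set R) : is_ideal (colon I A).
Proof.
split=> [q _|p q Ip Iq r Ar|a p Ip r Ar].
- by rewrite mul0r; apply: ideal0.
- by rewrite mulrDl; apply: idealD; [apply: Ip | apply: Iq].
- by rewrite -mulrA; apply: idealMl; apply: Ip.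
Qed.

Lemma ideal_add_ideal (J : set R) : is_ideal J -> is_ideal (ideal_add I J).
Proof.
move=> hJ; split=> [|_ _ [p Ip [q Jq <-]] [r Ir [s Js <-]]|a _ [p Ip [q Jq <-]]].
- by exists 0; [apply: ideal0 | exists 0; [case: hJ | rewrite addr0]].
- exists (p + r); first exact: idealD.
  by exists (q + s); [case: hJ => _ h _; apply: h | rewrite addrACA].
- exists (a * p); first exact: idealMl.
  by exists (a * q); [case: hJ => _ _; apply | rewrite mulrDr].
Qed.

End IdealTheory.

Lemma ltn_sum_at (I : finType) (P : pred I) (F H : I -> nat) (k : I) :
  (forall i, P i -> F i <= H i)%N -> P k -> (F k < H k)%N ->
  (\sum_(i | P i) F i < \sum_(i | P i) H i)%N.
Proof.
move=> leFH Pk ltk; rewrite (bigD1 k) // [ltnRHS](bigD1 k) //= -addSn.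
by apply: leq_add => //; apply: leq_sum => i /andP[/leFH].
Qed.

(** * Homogeneous parts in S, and monomials in terms of the g_{C,D} *)

Section Grading.
Variables (K : fieldType) (n : nat).
Implicit Types (m e : 'X_{1..n + n}) (p q : {mpoly K[n + n]}).
Implicit Types (Q : pred 'X_{1..n}) (C D B : {set 'I_n}).

(* The [Z^n]-grading in which x_k and y_k both have degree e_k. *)
Definition vdeg m : 'X_{1..n} :=
  [multinom (m (lshift n k) + m (rshift n k))%N | k < n].

Lemma vdegE m k : vdeg m k = (m (lshift n k) + m (rshift n k))%N.
Proof. by rewrite mnmE. Qed.

Lemma vdegD m e : vdeg (m + e) = (vdeg m + vdeg e)%MM.
Proof. by apply/mnmP=> k; rewrite mnmDE !vdegE !mnmDE; lia. Qed.

Lemma vdegl (k : 'I_n) : vdeg U_(lshift n k) = U_(k)%MM.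
Proof. by apply/mnmP=> t; rewrite vdegE !mnm1E eq_lshift eq_lrshift addn0. Qed.

Lemma vdegr (k : 'I_n) : vdeg U_(rshift n k) = U_(k)%MM.
Proof. by apply/mnmP=> t; rewrite vdegE !mnm1E eq_rshift eq_rlshift. Qed.

(** A predicate selects the degrees, rather than one degree: multiplication by a monomial then just
    shifts [Q], with no subtraction of exponents. *)
Definition gpart Q p : {mpoly K[n + n]} :=
  \sum_(m <- msupp p | Q (vdeg m)) p@_m *: 'X_[m].

Lemma mcoeff_gpart Q p m : (gpart Q p)@_m = if Q (vdeg m) then p@_m else 0.
Proof.
rewrite /gpart raddf_sum /=.
have [mp|mp] := boolP (m \in msupp p); last first.
  rewrite (memN_msupp_eq0 mp) if_same big1_seq // => e /andP[_ ep].
  rewrite mcoeffZ mcoeffX; case: eqP => [em|_]; last by rewrite mulr0.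
  by rewrite -em ep in mp.
rewrite big_mkcond (bigD1_seq m) ?msupp_uniq //= big1 => [|e em].
  by rewrite addr0 mcoeffZ mcoeffX eqxx mulr1.
by case: ifP => // _; rewrite mcoeffZ mcoeffX (negPf em) mulr0.
Qed.

Lemma gpart0 Q : gpart Q 0 = 0.
Proof. by apply/mpolyP=> m; rewrite mcoeff_gpart !mcoeff0 if_same. Qed.

Lemma gpartD Q p q : gpart Q (p + q) = gpart Q p + gpart Q q.
Proof.
by apply/mpolyP=> m; rewrite mcoeffD !mcoeff_gpart mcoeffD; case: ifP; rewrite ?addr0.
Qed.

Lemma gpartB Q p q : gpart Q (p - q) = gpart Q p - gpart Q q.
Proof.
by apply/mpolyP=> m; rewrite mcoeffB !mcoeff_gpart mcoeffB; case: ifP; rewrite ?subr0.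
Qed.

Lemma eq_gpart Q1 Q2 p : Q1 =1 Q2 -> gpart Q1 p = gpart Q2 p.
Proof. by move=> eqQ; apply/mpolyP=> m; rewrite !mcoeff_gpart eqQ. Qed.

Lemma gpartZX Q (c : K) m :
  gpart Q (c *: 'X_[m]) = if Q (vdeg m) then c *: 'X_[m] else 0.
Proof.
apply/mpolyP=> e; rewrite mcoeff_gpart mcoeffZ mcoeffX.
have [<-|em] := eqVneq m e.
  by case: ifP; rewrite ?mcoeffZ ?mcoeffX ?eqxx ?mcoeff0.
by case: ifP; case: ifP; rewrite ?mcoeffZ ?mcoeffX ?(negPf em) ?mcoeff0 ?mulr0.
Qed.

Lemma gpartMX Q p e :
  gpart Q (p * 'X_[e]) = gpart (fun a => Q (a + vdeg e)%MM) p * 'X_[e].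
Proof.
elim/mpolyind: p => [|c m p _ _ IHp]; first by rewrite mul0r !gpart0 mul0r.
rewrite mulrDl !gpartD mulrDl IHp -scalerAl -mpolyXD !gpartZX vdegD.
by congr (_ + _); case: ifP; rewrite ?mul0r // mpolyXD scalerAl.
Qed.

Lemma gpart_sum p :
  p = \sum_(a <- undup [seq vdeg m | m <- msupp p]) gpart (pred1 a) p.
Proof.
apply/mpolyP=> m; rewrite raddf_sum /=.
under eq_bigr do rewrite mcoeff_gpart /=.
have [mp|mp] := boolP (m \in msupp p); last first.
  by rewrite (memN_msupp_eq0 mp) big1 // => a _; rewrite if_same.
rewrite (bigD1_seq (vdeg m)) ?undup_uniq ?mem_undup ?map_f //= eqxx big1 ?addr0 //.
by move=> a am; rewrite eq_sym (negPf am).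
Qed.

Lemma edge_binomE (i j : 'I_n) : edge_binom K i j =
  'X_[U_(lshift n i) + U_(rshift n j)] - 'X_[U_(lshift n j) + U_(rshift n i)].
Proof. by rewrite !mpolyXD. Qed.

Lemma edge_binomC (i j : 'I_n) : edge_binom K j i = - edge_binom K i j.
Proof. by rewrite /edge_binom; ring. Qed.

Lemma edge_binom_neq0 (i j : 'I_n) : i != j -> edge_binom K i j != 0.
Proof.
move=> ij; apply/eqP => /mpolyP/(_ (U_(lshift n i) + U_(rshift n j))%MM).
rewrite edge_binomE mcoeffB !mcoeffX mcoeff0 eqxx.
case: eqP => [/mnmP/(_ (lshift n i))|_].
  rewrite !mnmDE !mnm1E !eq_lshift eqxx !eq_rlshift.
  by rewrite eq_sym (negPf ij).
by rewrite subr0 => /eqP; rewrite oner_eq0.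
Qed.

Lemma gpartM_edge Q p (i j : 'I_n) : gpart Q (p * edge_binom K i j) =
  gpart (fun a => Q (a + (U_(i) + U_(j)))%MM) p * edge_binom K i j.
Proof.
rewrite edge_binomE !mulrBr gpartB !gpartMX; congr (_ - _); congr (_ * _);
by apply: eq_gpart => a; rewrite vdegD vdegl vdegr // [(U_(j) + _)%MM]addmC.
Qed.

(** For each k in the support of the degree, take x_k if it divides the monomial and y_k otherwise;
    this choice makes C and D disjoint. *)
Lemma gmon_dvd m : exists q C D,
  [/\ 'X_[m] = q * gmon K C D, (C :&: D)%SET = finset.set0
    & forall k, (k \in (C :|: D)%SET) = (0 < vdeg m k)%N].
Proof.
pose C := [set k | 0 < m (lshift n k)]%SET%N.
pose D := [set k | (m (lshift n k) == 0) && (0 < m (rshift n k))]%SET%N.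
exists ((\prod_k xvar K k ^+ (m (lshift n k) - (k \in C))) *
        (\prod_k yvar K k ^+ (m (rshift n k) - (k \in D)))), C, D.
split; last by move=> k; rewrite !inE vdegE; lia.
  rewrite mpolyXE_id big_split_ord /= /gmon.
  rewrite [X in _ = _ * (X * _)]big_mkcond [X in _ = _ * (_ * X)]big_mkcond /=.
  rewrite mulrACA; congr (_ * _); rewrite -big_split /=; apply: eq_bigr => k _.
    by rewrite inE; case: (m _) => [|u] /=; rewrite ?mulr1 // subn1 /= exprSr.
  rewrite inE; case: eqP => _ /=; last by rewrite subn0 mulr1.
  by case: (m _) => [|u] /=; rewrite ?mulr1 // subn1 /= exprSr.
by apply/setP=> k; rewrite !inE; lia.
Qed.

End Grading.

(** * Elements of J_G obtained from paths of G *)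

Section Graph.
Variables (K : fieldType) (n : nat) (G : rel 'I_n).
Hypotheses (Gsym : ssrbool.symmetric G) (Girr : irreflexive G).
Implicit Types (m e : 'X_{1..n + n}) (p q : {mpoly K[n + n]}).
Implicit Types (A B C D : {set 'I_n}) (i j k l : 'I_n).

Let J := binom_edge_ideal K G.

Let hJ : is_ideal J.
Proof. exact: ideal_gen_ideal. Qed.

Lemma mem_edge_binom i j : G i j -> J (edge_binom K i j).
Proof.
move=> Gij; case: (ltngtP i j) => [ij|ij|/val_inj ij].
- by apply: mem_ideal_gen; exists i, j.
- rewrite edge_binomC; apply: (idealN hJ).
  by apply: mem_ideal_gen; exists j, i; rewrite Gsym.
- by rewrite ij Girr in Gij.
Qed.

Lemma gpart_binom_edge_ideal p (Q : pred 'X_{1..n}) : J p -> J (gpart Q p).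
Proof.
(* The set quantifies over all [Q], since multiplying by a monomial replaces [Q] by a shifted
   predicate. *)
suff: J `<=` [set p | forall Q, J (gpart Q p)] by move=> h /h; apply.
apply: ideal_gen_sub => [|_ [i [j [_ Gij ->]]] {}Q].
  split=> [{}Q|p1 p2 h1 h2 {}Q|a {}p hp].
  - by rewrite gpart0; apply: (ideal0 hJ).
  - by rewrite gpartD; apply: (idealD hJ).
  rewrite [a]mpolyE mulr_suml => {}Q.
  elim/big_rec: _ => [|m q _ IHq]; first by rewrite gpart0; apply: (ideal0 hJ).
  rewrite gpartD; apply: (idealD hJ) => //.
  rewrite -scalerAl mulrC scalerAl gpartMX; apply: (idealMr hJ) => //.
  set Q' := (fun _ => _); have -> : gpart Q' (a@_m *: p) = a@_m *: gpart Q' p.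
    by apply/mpolyP=> e; rewrite mcoeffZ !mcoeff_gpart mcoeffZ; case: ifP; rewrite ?mulr0.
  by rewrite -mul_mpolyC; apply: (idealMl hJ).
rewrite -[edge_binom K i j]mul1r gpartM_edge; apply: (idealMl hJ) => //.
exact: mem_edge_binom.
Qed.

(** Induction along the path by z_t f_ij = z_i f_tj + z_j f_it, valid for z = x and for z = y. *)
Lemma prod_path_edge C i j (s : seq 'I_n) : path G i (rcons s j) ->
  J ((\prod_(t <- s) (if t \in C then xvar K t else yvar K t)) * edge_binom K i j).
Proof.
elim: s i => [|t s IHs] i /= /andP[Git].
  by move=> _; rewrite big_nil mul1r; apply: mem_edge_binom.
move=> /IHs; rewrite big_cons; set q := \prod_(_ <- _) _ => Jq.
have Jit := mem_edge_binom Git; case: ifP => _.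
  have -> : xvar K t * q * edge_binom K i j =
      xvar K i * (q * edge_binom K t j) + q * xvar K j * edge_binom K i t.
    by rewrite /edge_binom; ring.
  exact: (idealD hJ (idealMl hJ _ Jq) (idealMl hJ _ Jit)).
have -> : yvar K t * q * edge_binom K i j =
    yvar K i * (q * edge_binom K t j) + q * yvar K j * edge_binom K i t.
  by rewrite /edge_binom; ring.
exact: (idealD hJ (idealMl hJ _ Jq) (idealMl hJ _ Jit)).
Qed.

(** As C and D are disjoint, g_{C,D} has exactly one variable per vertex of their union; [uniq s]
    makes the product over [s] a factor of it. *)
Lemma gmon_path_edge C D i j (s : seq 'I_n) : (C :&: D)%SET = finset.set0 ->
  path G i (rcons s j) -> uniq s -> {subset s <= (C :|: D)%SET} ->
  J (gmon K C D * edge_binom K i j).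
Proof.
move=> CD0 Gs us sCD.
have dCD : fintype.disjoint (mem C) (mem D) by rewrite -setI_eq0 CD0.
have -> : gmon K C D =
    \prod_(t in (C :|: D)%SET) (if t \in C then xvar K t else yvar K t).
  rewrite (eq_bigl [predU C & D]) => [|t]; last by rewrite !inE.
  rewrite bigU //=; congr (_ * _); apply: eq_bigr => t; first by move=> ->.
  by move=> tD; rewrite (disjointFl dCD tD).
rewrite (bigID (mem s)) /= (eq_bigl (mem s)) => [|t]; last first.
  by rewrite andb_idl //; apply: sCD.
rewrite -big_uniq // mulrAC; apply: (idealMr hJ).
exact: prod_path_edge.
Qed.

(** * Connectivity in induced subgraphs and swaps of variables *)

Definition inner_rel A : rel 'I_n := [rel k l | [&& G k l, k \in A & l \in A]].

Lemma inner_rel_sym A : connect_sym (inner_rel A).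
Proof.
by apply: sym_connect_sym => k l; rewrite /inner_rel /= Gsym; congr (_ && _); rewrite andbC.
Qed.

Lemma inner_rel_path A i j : i != j -> connect (inner_rel A) i j ->
  exists s, [/\ path G i (rcons s j), uniq (i :: rcons s j)
    & {subset s <= A :\: [set i; j]}%SET].
Proof.
move=> ij /connectP[p0 /shortenP[p Gp up _] jE].
case/lastP: p Gp up jE => [|s t] Gp up; first by move=> /= jE; rewrite jE eqxx in ij.
rewrite last_rcons => jE; subst t; exists s; split=> //.
  by apply: sub_path Gp => k l /= /andP[].
move=> t ts; rewrite !inE.
have -> : t \in A.
  move: Gp; rewrite rcons_path => /andP[Gp _].
  elim: s i ts Gp {up ij} => //= u s IHs i; rewrite inE.
  by case: eqP => [-> _ /andP[/and3P[_ _ ->]]//|_ /= ts /andP[_]]; apply: IHs.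
move: up; rewrite /= mem_rcons inE rcons_uniq negb_or => /andP[/andP[_ is_]/andP[js _]].
rewrite andbT; apply/norP.
by split; [apply: contraNneq is_ => <- | apply: contraNneq js => <-].
Qed.

(** The degree is left free at [k] and [l] because a swap applies this to the cofactor of x_l y_k,
    whose degree may vanish there. *)
Lemma monom_connect_edge m B k l : k != l -> connect (inner_rel B) k l ->
  (forall t, t \in B -> t != k -> t != l -> (0 < vdeg m t)%N) ->
  J ('X_[m] * edge_binom K k l).
Proof.
move=> kl /(inner_rel_path kl)[s [Gs us sB]] mB.
have [q [C [D [-> CD0 CDE]]]] := gmon_dvd K m.
rewrite -mulrA; apply: (idealMl hJ).
apply: gmon_path_edge CD0 Gs _ _.
  by move: us; rewrite /= rcons_uniq => /and3P[].
move=> t /sB; rewrite !inE => /andP[/norP[tk tl] tB].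
by have := CDE t; rewrite !inE => ->; apply: mB.
Qed.


(* Swapping x_l y_k for x_k y_l changes a monomial by a multiple of f_lk; such
   swaps connect any two monomials with the same degree and the same number of
   y's in each class of [c]. *)
Lemma monom_swap_mem B (c : 'I_n -> 'I_n) :
  (forall k l, k \in B -> l \in B -> c k = c l -> connect (inner_rel B) k l) ->
  forall m e, vdeg m = vdeg e -> (forall k, (k \in B) = (0 < vdeg m k)%N) ->
  (forall z, \sum_(k | c k == z) m (rshift n k) =
             \sum_(k | c k == z) e (rshift n k))%N ->
  J ('X_[m] - 'X_[e]).
Proof.
move=> cB m e.
(* The measure counts the surplus y's of [m] over [e]; subtraction is truncated, so gaining a y at a
   vertex with a deficit costs nothing. *)
have [N] := ubnP (\sum_k (m (rshift n k) - e (rshift n k)))%N.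
elim: N m => // N IHN m /ltnSE leN me mB sme.
have [/existsP[k km]|/existsPn nk] := boolP [exists k, e (rshift n k) < m (rshift n k)]%N.
  (* Equal sums over the class of [k] force a deficit of y's at some [l] in it; since the degrees
     agree, x_l then divides [m]. *)
  have /existsP[l /andP[/eqP ckl lm]] :
      [exists l, (c l == c k) && (m (rshift n l) < e (rshift n l))]%N.
    apply/existsPn => nl; move: (sme (c k)); apply/eqP; rewrite neq_ltn orbC.
    rewrite (ltn_sum_at (k := k)) // => l ckl.
    by move: (nl l); rewrite ckl -leqNgt.
  have mel := congr1 (fun a : 'X_{1..n} => a l) me.
  rewrite !vdegE in mel.
  have kl : k != l by apply: contraTneq km => ->; lia.
  pose m0 := (m - (U_(rshift n k) + U_(lshift n l)))%MM.
  have mE : m = (m0 + (U_(rshift n k) + U_(lshift n l)))%MM.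
    rewrite submK //; apply/mnm_lepP => i; rewrite mnmDE !mnm1E.
    case: (split_ordP i) => t ->.
      by rewrite eq_rlshift eq_lshift; case: eqP => // <-; lia.
    by rewrite eq_lrshift eq_rshift addn0; case: eqP => // <-; lia.
  pose m1 := (m0 + (U_(lshift n k) + U_(rshift n l)))%MM.
  have m1r t : (m1 (rshift n t) = m0 (rshift n t) + (l == t))%N.
    by rewrite !mnmDE !mnm1E eq_lrshift eq_rshift.
  have mr t : (m (rshift n t) = m0 (rshift n t) + (k == t))%N.
    by rewrite mE !mnmDE !mnm1E eq_lrshift eq_rshift addn0.
  have vm1 : vdeg m1 = vdeg m.
    by rewrite mE !vdegD !vdegl !vdegr.
  have -> : 'X_[m] - 'X_[e] =
      'X_[m0] * edge_binom K l k + ('X_[m1] - 'X_[e]) :> {mpoly K[n + n]}.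
    by rewrite mE edge_binomE !mpolyXD; ring.
  have sm1 z : (\sum_(t | c t == z) m1 (rshift n t) =
                \sum_(t | c t == z) m (rshift n t))%N.
    under eq_bigr do rewrite m1r; under [in RHS]eq_bigr do rewrite mr.
    have delta u : (\sum_(t | c t == z) (u == t) = (c u == z))%N.
      rewrite big_mkcond (bigD1 u) //= eqxx big1 ?addn0 => [|t tu].
        by case: (c u == z).
      by rewrite [u == t]eq_sym (negPf tu) if_same.
    by rewrite !big_split /= !delta ckl.
  apply: (idealD hJ).
    apply: (@monom_connect_edge _ B); rewrite 1?eq_sym //.
      by apply: cB => //; rewrite mB vdegE; lia.
    move=> t tB tl tk; have := tB; rewrite mB mE vdegD mnmDE.
    by rewrite vdegD vdegl vdegr mnmDE !mnm1E ![_ == t]eq_sym (negPf tl) (negPf tk) !addn0.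
  apply: IHN => [||t|z]; rewrite ?vm1 ?sm1 //.
  apply: leq_trans leN; apply: (ltn_sum_at (k := k)) => // [t _|].
    rewrite m1r mr; have [<-|] := eqVneq l t; last by lia.
    by move: lm; rewrite mr; lia.
  by rewrite m1r mr eqxx [l == k]eq_sym (negPf kl); move: km; rewrite mr eqxx; lia.
(* No surplus and equal class sums leave equal y-exponents; equal degrees then give equal
   x-exponents. *)
have le k : (m (rshift n k) <= e (rshift n k))%N by rewrite leqNgt; apply: nk.
have eqr k : m (rshift n k) = e (rshift n k).
  apply/eqP; rewrite eqn_leq le /= leqNgt; apply/negP => lt.
  by have := sme (c k); apply/eqP; rewrite neq_ltn (ltn_sum_at (k := k)).
suff -> : m = e by rewrite subrr; apply: ideal0.
apply/mnmP => i; case: (split_ordP i) => k -> //.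
by have := congr1 (fun a : 'X_{1..n} => a k) me; rewrite /= !vdegE eqr; lia.
Qed.

(** * The map merging vertices along [c] and killing the variables outside [A] *)

Section Collapse.
Variables (A : {set 'I_n}) (c : 'I_n -> 'I_n).

Definition collapse_var (i : 'I_(n + n)) : {mpoly K[n + n]} :=
  match fintype.split i with
  | inl k => if k \in A then xvar K (c k) else 0
  | inr k => if k \in A then yvar K (c k) else 0
  end.

Definition collapse : {mpoly K[n + n]} -> {mpoly K[n + n]} :=
  mmap (@mpolyC (n + n) K) collapse_var.

(** Exponent of the image of ['X_[m]] when the degree of [m] is supported in [A]; the killing of
    variables is not recorded here. *)
Definition collapse_mnm m : 'X_{1..n + n} :=
  (\sum_k U_(lshift n (c k)) *+ m (lshift n k) +
   \sum_k U_(rshift n (c k)) *+ m (rshift n k))%MM.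

Lemma collapse_mnmr m z :
  collapse_mnm m (rshift n z) = (\sum_(k | c k == z) m (rshift n k))%N.
Proof.
rewrite mnmDE !mnm_sumE big1 => [|k _]; last by rewrite mulmnE mnm1E eq_lrshift.
rewrite add0n [RHS]big_mkcond /=; apply: eq_bigr => k _.
by rewrite mulmnE mnm1E eq_rshift; case: eqP => _; rewrite ?mul1n ?mul0n.
Qed.

Lemma collapsel k :
  collapse_var (lshift n k) = if k \in A then xvar K (c k) else 0.
Proof. by rewrite /collapse_var (unsplitK (inl k)). Qed.

Lemma collapser k :
  collapse_var (rshift n k) = if k \in A then yvar K (c k) else 0.
Proof. by rewrite /collapse_var (unsplitK (inr k)). Qed.

Lemma collapseX m : (forall k, (0 < vdeg m k)%N -> k \in A) ->
  mmap1 collapse_var m = 'X_[collapse_mnm m].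
Proof.
move=> mA; rewrite /mmap1 big_split_ord /= mpolyXD; congr (_ * _).
  rewrite (big_morph _ (@mpolyXD _ _) (@mpolyX0 _ _));
  apply: eq_bigr => k _; rewrite collapsel -mpolyXn.
  (* A killed variable occurs with exponent 0, so its factor is 0^0 = 1. *)
  case: ifP => // kA; suff -> : m (lshift n k) = 0%N by rewrite !expr0.
  by apply/eqP; rewrite -leqn0 leqNgt; apply: contraFN kA => ?; apply: mA; rewrite vdegE; lia.
rewrite (big_morph _ (@mpolyXD _ _) (@mpolyX0 _ _));
apply: eq_bigr => k _; rewrite collapser -mpolyXn.
case: ifP => // kA; suff -> : m (rshift n k) = 0%N by rewrite !expr0.
by apply/eqP; rewrite -leqn0 leqNgt; apply: contraFN kA => ?; apply: mA; rewrite vdegE; lia.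
Qed.

Lemma collapse_edge i j : collapse (edge_binom K i j) =
  if (i \in A) && (j \in A) then edge_binom K (c i) (c j) else 0.
Proof.
rewrite /collapse /edge_binom rmorphB !rmorphM /= !mmapX !mmap1U !collapsel !collapser.
by do 2!case: ifP => _ //=; rewrite ?mul0r ?mulr0 ?subr0.
Qed.

(** Each generator is either killed or sent to some f_zz = 0, because [c] identifies the ends of an
    edge inside [A]. *)
Lemma collapse_binom_edge_ideal p :
  (forall i j, G i j -> i \in A -> j \in A -> c i = c j) ->
  J p -> collapse p = 0.
Proof.
move=> cG; suff: J `<=` [set p | collapse p = 0] by apply.
apply: ideal_gen_sub => [|_ [i [j [_ Gij ->]]]]; last first.
  rewrite /= collapse_edge; case: ifP => // /andP[iA jA].
  by rewrite (cG _ _ Gij iA jA) /edge_binom subrr.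
split=> [|p1 p2 /= h1 h2|q p1 /= h1]; rewrite /collapse.
- exact: rmorph0.
- by rewrite rmorphD /= -/collapse h1 h2 addr0.
- by rewrite rmorphM /= -/collapse h1 mulr0.
Qed.

(** Induction on the number of monomials of [p]: two with the same image are congruent modulo J_G,
    so one of them can be eliminated. *)
Lemma collapse_kernel B (a : 'X_{1..n}) p :
  (forall k, (k \in B) = (0 < a k)%N) -> B \subset A ->
  (forall k l, k \in B -> l \in B -> c k = c l -> connect (inner_rel B) k l) ->
  (forall m, m \in msupp p -> vdeg m = a) ->
  collapse p = 0 -> J p.
Proof.
move=> Ba BA cB; have [N] := ubnP (size (msupp p)).
elim: N p => // N IHN p /ltnSE leN pa p0.
have [->|pn0] := eqVneq p 0; first exact: ideal0.
have [m mp] : exists m, m \in msupp p by exists (mlead p); apply: mlead_supp.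
have aA e : vdeg e = a -> mmap1 collapse_var e = 'X_[collapse_mnm e].
  by move=> ea; apply: collapseX => k; rewrite ea -Ba; apply: (fintype.subsetP BA).
(* If no other monomial shared the image of [m], the coefficient of that image in [collapse p] would
   be [p@_m], which is nonzero. *)
have /hasP[e ep /andP[em /eqP cem]] :
    has (fun e => (e != m) && (collapse_mnm e == collapse_mnm m)) (msupp p).
  apply: contraPT p0 => /hasPn np /mpolyP/(_ (collapse_mnm m)).
  rewrite mcoeff0 /collapse /mmap raddf_sum /= (bigD1_seq m) ?msupp_uniq //=.
  rewrite big_seq_cond big1 ?addr0 => [|e /andP[ep em]].
    rewrite mcoeffCM aA ?pa // mcoeffX eqxx mulr1 => /eqP.
    by rewrite mcoeff_eq0 mp.
  rewrite mcoeffCM aA ?pa // mcoeffX; have := np e ep; rewrite em /= => /negPf ->.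
  by rewrite mulr0.
(* The correction removes [m] from the support and, as [e] is already there, adds no monomial. *)
have -> : p = (p - p@_m *: ('X_[m] - 'X_[e])) + p@_m *: ('X_[m] - 'X_[e]).
  by rewrite subrK.
set q := p - _.
have qE d : q@_d = p@_d - p@_m * ((m == d)%:R - (e == d)%:R).
  by rewrite mcoeffB mcoeffZ mcoeffB !mcoeffX.
have qp d : d \in msupp q -> d \in rem m (msupp p).
  rewrite mem_rem_uniq ?msupp_uniq // inE /= mcoeff_msupp qE.
  have [->|dm] := eqVneq d m.
    by rewrite (negPf em) subr0 mulr1 subrr eqxx.
  rewrite /=; apply: contraR => dp; rewrite (memN_msupp_eq0 dp).
  by have [ed|_] := eqVneq e d; [rewrite -ed ep in dp | rewrite subrr mulr0 subr0].
apply: (idealD hJ); last first.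
  rewrite -mul_mpolyC; apply: (idealMl hJ).
  (* The y-exponents of the common image are the sums over the classes of [c]. *)
  apply: (@monom_swap_mem B c) => // [|k|z]; rewrite ?pa //.
  by rewrite -!collapse_mnmr cem.
apply: IHN.
- apply: leq_trans leN; have -> : size (msupp p) = (size (rem m (msupp p))).+1.
    by rewrite (perm_size (perm_to_rem mp)).
  by rewrite ltnS uniq_leq_size ?msupp_uniq.
- by move=> d /qp /mem_rem /pa.
rewrite /collapse /q -mul_mpolyC mmapB rmorphM /= mmapB !mmapX !aA ?pa // cem.
by rewrite subrr mulr0 subr0.
Qed.

End Collapse.

(** * Sets outside D_c(G), and the homogeneous case *)

Lemma not_Dc_separator B : ~ Dc G B -> exists A i j,
  [/\ B \subset A, i \in A /\ j \in A, ~~ G i j, ~~ connect (inner_rel A) i j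
    & forall k l, k \in B -> l \in B ->
        connect (inner_rel A) k l -> connect (inner_rel B) k l].
Proof.
move=> nD.
have [/existsP[i /existsP[j /and3P[iB jB nij]]]|/existsPn conB] :=
    boolP [exists i, exists j, [&& i \in B, j \in B & ~~ connect (inner_rel B) i j]].
  exists B, i, j; split=> //; apply: contra nij => Gij.
  by apply: connect1; rewrite /inner_rel /= Gij iB.
(* Here any two vertices of [B] are connected in G[B]. If no separator exists, every non-edge {i,j}
   is joined by a path inside [B] with i, j added; its interior avoids i and j, hence lies in
   [B]. *)
apply: boolp.contrapT => nA; apply: nD => i j ij nGij.
pose A := (i |: (j |: B))%SET.
have [cA|nc] := boolP (connect (inner_rel A) i j).
  have [s [Gs us sA]] := inner_rel_path ij cA; exists s; split=> // t /sA.
  by rewrite !inE; case: (t == i); case: (t == j).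
case: nA; exists A, i, j; split=> //.
    by apply/fintype.subsetP => k; rewrite !inE => ->; rewrite !orbT.
  by rewrite !inE !eqxx !orbT.
move=> k l kB lB _; have /existsPn/(_ l) := conB k.
by rewrite kB lB negbK.
Qed.

Lemma homog_colon_nonedges (a : 'X_{1..n}) p :
  (forall m, m \in msupp p -> vdeg m = a) ->
  (forall i j, (i < j)%N -> ~~ G i j -> J (p * edge_binom K i j)) ->
  ideal_add J (gmon_ideal K G) p.
Proof.
move=> pa pJ; pose B := [set k | 0 < a k]%SET%N.
have [DB|/not_Dc_separator[A [i [j [BA [iA jA] nGij nij cB]]]]] := boolp.EM (Dc G B).
  exists 0; first exact: ideal0.
  exists p; last by rewrite add0r.
  have hg : is_ideal (gmon_ideal K G) by apply: ideal_gen_ideal.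
  rewrite [p]mpolyE; apply: (ideal_sum hg) => m mp _.
  have [q [C [D [-> CD0 CDE]]]] := gmon_dvd K m.
  rewrite -mul_mpolyC mulrA; apply: (idealMl hg); apply: mem_ideal_gen.
  exists C, D; split=> //; suff -> : (C :|: D)%SET = B by [].
  by apply/setP => k; rewrite CDE inE (pa m mp).
exists p; last by exists 0; rewrite ?addr0 //; apply: ideal0; apply: ideal_gen_ideal.
pose c := fingraph.root (inner_rel A).
have cP k l : reflect (c k = c l) (connect (inner_rel A) k l).
  by apply: fingraph.rootP; apply: inner_rel_sym.
apply: (@collapse_kernel A c B a) => // [k|k l kB lB /cP|]; first by rewrite inE.
  exact: cB.
have ij : i != j by apply: contraNneq nij => ->; apply: connect0.
have : J (p * edge_binom K i j).
  case: (ltngtP i j) => [lij|lij|/val_inj eij]; first exact: pJ.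
    by rewrite edge_binomC mulrN; apply: (idealN hJ); apply: pJ; rewrite // Gsym.
  by rewrite eij eqxx in ij.
have cG k l : G k l -> k \in A -> l \in A -> c k = c l.
  by move=> Gkl kA lA; apply/cP/connect1; rewrite /inner_rel /= Gkl kA.
move=> /(collapse_binom_edge_ideal cG)/eqP.
rewrite {1}/collapse rmorphM /= -!/(collapse A c _) collapse_edge iA jA /=.
(* S is a domain, and the image of f_ij is nonzero because i and j lie in different components of
   G[A]. *)
rewrite mulf_eq0 orbC (negPf (edge_binom_neq0 _ _)) => [/eqP //|].
by apply: contra nij => /eqP/cP.
Qed.

End Graph.

(** * The two equalities, by passing to generators and to homogeneous parts *)

Unset Implicit Arguments.

Theorem proposition3p6 (K : fieldType) (n : nat) (G : rel 'I_n)
    (Gsym : ssrbool.symmetric G) (Girr : irreflexive G)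
    (GnK : ~ (G =2 complete_graph n)) :
  colon (binom_edge_ideal K G) (binom_edge_ideal K (complete_graph n)) =
    \bigcap_(e in nonedges G)
      colon (binom_edge_ideal K G) [set edge_binom K e.1 e.2]
  /\
  \bigcap_(e in nonedges G)
      colon (binom_edge_ideal K G) [set edge_binom K e.1 e.2] =
    ideal_add (binom_edge_ideal K G) (gmon_ideal K G).
Proof.
have hJ : is_ideal (binom_edge_ideal K G) by apply: ideal_gen_ideal.
split; apply/seteqP; split=> p.
- move=> pK [i j] [/= ij _] _ ->; apply: pK; apply: mem_ideal_gen.
  by exists i, j; split=> //; rewrite /complete_graph neq_ltn ij.
- move=> pN; suff: (binom_edge_ideal K (complete_graph n) `<=`
      [set q | binom_edge_ideal K G (p * q)])%classic by apply.
  apply: ideal_gen_sub => [|_ [i [j [ij _ ->]]]].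
    split=> [|q r qJ rJ|a q qJ] /=.
    + by rewrite mulr0; apply: ideal0.
    + by rewrite mulrDr; exact: (idealD hJ).
    + by rewrite mulrCA; exact: (idealMl hJ).
  have [Gij|nGij] := boolP (G i j); last exact: (pN (i, j)).
  by apply: (idealMl hJ); apply: mem_edge_binom.
- move=> pN; have hI : is_ideal (ideal_add (binom_edge_ideal K G) (gmon_ideal K G)).
    by apply: ideal_add_ideal => //; apply: ideal_gen_ideal.
  rewrite [p]gpart_sum; apply: (ideal_sum hI) => a _ _.
  apply: (homog_colon_nonedges Gsym Girr (a := a)) => [m|i j ij nGij].
    by rewrite mcoeff_msupp mcoeff_gpart /=; case: (vdeg m =P a) => // _; rewrite eqxx.
  (* The part of p f_ij in degree a + e_i + e_j is f_ij times the part of p in degree a, as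
     translation of degrees is injective. *)
  have := @gpart_binom_edge_ideal K n G Gsym Girr _
    (pred1 (a + (U_(i) + U_(j))))%MM (pN (i, j) (conj ij nGij) _ erefl).
  rewrite gpartM_edge; congr (binom_edge_ideal K G (_ * _)).
  by apply: eq_gpart => b /=; rewrite (inj_eq (@addIm _ _)).
- move=> [q qJ [r rg <-]] [i j] [/= ij nGij] _ ->.
  rewrite mulrDl; apply: (idealD hJ); first exact: (idealMr hJ).
  suff: (gmon_ideal K G `<=` colon (binom_edge_ideal K G) [set edge_binom K i j])%classic.
    by apply.
  apply: ideal_gen_sub; first exact: colon_ideal.
  move=> _ [C [D [DCD CD0 ->]]] _ ->.
  have neij : i != j by rewrite neq_ltn ij.
  have [s [Gs us sCD]] := DCD i j neij nGij.
  apply: (gmon_path_edge Gsym Girr CD0 Gs) => //.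
  by move: us; rewrite /= rcons_uniq => /and3P[].
Qed.
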